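(* Let $d$ be a positive integer. If $G$ is a connected finite simple graph with girth $\mathrm{gir}(G)\ge 4d-1$, then $\pi^{c}(G)\le 2^{d}\gamma_d(G)$.
   Context: For a vertex $v$, $N_d[v]=\{u:\mathrm{dist}(u,v)\le d\}$. A set $S\subseteq V(G)$ is a distance-$d$ dominating set if $\bigcup_{v\in S}N_d[v]=V(G)$, and $\gamma_d(G)$ is the minimum size of such a set. Acyclic graphs have infinite girth. A configuration of cops on $G$ is a function $C:V(G)\to\mathbb{Z}_{\ge 0}$ of size $\sum_v C(v)$. A pebbling step from a vertex $u$ with at least two cops to an adjacent vertex $v$ removes two cops from $u$ and adds one cop to $v$. In the cops and robbers pebbling game, cops are placed according to $C$, then a robber chooses a starting vertex; thereafter, in each turn the cops make pebbling steps, after which the robber either moves to an adjacent vertex or stays put. The robber is captured when he occupies a vertex holding at least one cop. The cop pebbling number $\pi^{c}(G)$ is the minimum $m$ such that some configuration of size $m$ allows the cops to capture the robber regardless of how he starts and moves. *)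

(* Defs.v *)
From mathcomp Require Import all_boot.
From mathcomp Require Import boolp.

Set Implicit Arguments.
Unset Strict Implicit.
Unset Printing Implicit Defensive.

(* Elements of [option nat] stand for natural numbers extended with
   [None] = infinity. *)
Definition leq_ext_nat (x : option nat) (n : nat) : bool :=
  if x is Some m then m <= n else false.

Definition leq_nat_ext (n : nat) (x : option nat) : bool :=
  if x is Some m then n <= m else true.

(* A finite simple graph is a finType [T] with a symmetric irreflexive
   adjacency relation [e : rel T]. *)
Section Graph.
Variables (T : finType) (e : rel T).

Definition connected_graph : bool :=
  (0 < #|T|) && [forall x, [forall y, connect e x y]].

Definition has_walk (n : nat) (x y : T) : bool :=
  [exists p : n.-tuple T, path e x p && (last x p == y)].

(* A shortest walk has fewer than #|T| edges, so no length is missed. *)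
Definition dist (x y : T) : option nat :=
  ohead [seq n <- iota 0 #|T| | has_walk n x y].

(* Applied below to n >= 3 only, which excludes the degenerate closed walks
   x - x and x - y - x. *)
Definition has_cycle (n : nat) : bool :=
  [exists c : n.-tuple T, cycle e c && uniq c].

(* A cycle has at most #|T| vertices, so no length is missed; the value is
   [None], i.e. infinity, exactly when the graph is acyclic. *)
Definition girth : option nat :=
  ohead [seq n <- iota 3 #|T| | has_cycle n].

Definition dist_ball (d : nat) (v : T) : {set T} :=
  [set u | leq_ext_nat (dist u v) d].

Definition dist_dominating (d : nat) (S : {set T}) : bool :=
  \bigcup_(v in S) dist_ball d v == [set: T].

(* The default [set: T] is always distance-d dominating. *)
Definition dist_domination_number (d : nat) : nat :=
  #|[arg min_(S < [set: T] | dist_dominating d S) #|S|]|.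

Definition configuration := {ffun T -> nat}.

Definition config_size (C : configuration) : nat := \sum_v C v.

(* One turn of the cops: [m u v] is the number of pebbling steps made from u
   to v.  The steps of a turn are simultaneous: both cops used by a step from
   u are on u at the beginning of the turn, so no cop advances by more than
   one edge per turn.  (If steps could be chained within a turn, the robber
   could be caught only during the first turn, and the game would reduce to
   optimal pebbling.)  Making no step is allowed. *)
Definition cop_turn (C C' : configuration) : Prop :=
  exists m : T -> T -> nat,
    [/\ forall u v, 0 < m u v -> e u v,
        forall u, 2 * (\sum_v m u v) <= C u
      & forall v, C' v = C v - 2 * (\sum_w m v w) + \sum_u m u v].

(* [cops_win C r]: with cops at [C], the robber at [r] and the cops to play,
   the cops can force a capture in finitely many turns. *)
Inductive cops_win : configuration -> T -> Prop :=
| robber_on_cop (C : configuration) r : 0 < C r -> cops_win C r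
| capture_by_turn (C C' : configuration) r : cop_turn C C' -> 0 < C' r -> cops_win C r
| chase_by_turn C C' r : cop_turn C C' ->
    (forall r', (r' == r) || e r r' -> cops_win C' r') -> cops_win C r.

Definition winning_config (C : configuration) : Prop :=
  forall r, cops_win C r.

Definition enough_cops (m : nat) : bool :=
  `[< exists C, config_size C = m /\ winning_config C >].

Lemma enough_cops_ex : exists m, enough_cops m.
Proof.
exists (config_size [ffun=> 1]); apply/asboolP.
exists [ffun=> 1]; split=> // r.
by apply: robber_on_cop; rewrite ffunE.
Qed.

Definition cop_pebbling_number : nat := ex_minn enough_cops_ex.

End Graph.

(* Main.v *)
Require Import Defs.
From mathcomp Require Import all_boot.
From mathcomp Require Import boolp zify.

Set Implicit Arguments.
Unset Strict Implicit.
Unset Printing Implicit Defensive.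

(** Put [2 ^ d] cops on each vertex of a minimum distance-[d] dominating set,
    and let each group repeatedly send half of its cops one edge towards the
    robber along a short path, so that after [i] turns a group has [2 ^ (d - i)]
    cops. With [k = d - i], the invariant is that every vertex [u] at distance at
    most [k - 1] from the robber [r] is at distance at most [k] from a group.
    If that group stands at [x], then the walk from [x] through [u] to [r] has
    length at most [2 * k - 1]; by the girth condition it visits the vertex [c]
    to which the group steps, so [c] is at distance at most [k - 1] from [u],
    whether it is met before or after [u]. *)

Section Graph.
Variables (T : finType) (e : rel T).
Implicit Types (x y r u : T) (k n : nat) (C : configuration T).

(** Walks of bounded length replace [dist]: they concatenate and split with no minimality to
    maintain. *)
Definition within k x y : Prop :=
  exists p, [/\ path e x p, last x p = y & size p <= k].

Lemma within0 x y : within 0 x y -> x = y.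
Proof. by move=> [[|z p] [_ /= <-]]. Qed.

Lemma within_refl k x : within k x x.
Proof. by exists [::]. Qed.

Lemma within_trans k l x y z :
  within k x y -> within l y z -> within (k + l) x z.
Proof.
move=> [p [ep lp sp]] [q [eq lq sq]]; exists (p ++ q).
by rewrite cat_path ep lp eq last_cat lp lq size_cat leq_add.
Qed.

Lemma within_sym : symmetric e -> forall k x y, within k x y -> within k y x.
Proof.
move=> e_sym k x y [p [ep lp sp]]; exists (rev (belast x p)).
rewrite -lp rev_path (eq_path (e' := e)) => [|u v]; last by rewrite e_sym.
split; rewrite ?size_rev ?size_belast //.
by case: p {ep lp sp} => //= z p; rewrite rev_cons last_rcons.
Qed.

Lemma dist_ball_within d u v : u \in dist_ball e d v -> within d u v.
Proof.
rewrite inE /dist; set s := filter _ _.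
case def_s: s => [|n s'] //= le_nd.
have: n \in s by rewrite def_s mem_head.
rewrite mem_filter => /andP[/existsP[p /andP[ep /eqP lp]] _].
by exists p; rewrite size_tuple.
Qed.

Lemma girth_cycle m (c : seq T) :
  leq_nat_ext m (girth e) -> 2 < size c -> cycle e c -> uniq c -> m <= size c.
Proof.
rewrite /girth => le_m c_gt2 ec Uc; move: le_m; set s := filter _ _.
have c_s : size c \in s.
  rewrite mem_filter mem_iota c_gt2 /=.
  have: size c <= #|T| by rewrite -(card_uniqP Uc) max_card.
  rewrite -ltnS => /ltn_addl-/(_ 2) => le_cT; rewrite andbC; apply/andP; split=> //.
  by apply/existsP; exists (in_tuple c); rewrite ec.
(* The candidate lengths are listed in increasing order, so the head of [s], which is the girth, is
   the least. *)
have: sorted leq s.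
  by apply: sorted_filter; [exact: leq_trans | exact: iota_sorted].
case: s c_s => [|n s] //=; rewrite inE => /predU1P[-> // | c_s].
rewrite (path_sortedE leq_trans) => /andP[/allP le_n _] le_m.
exact: leq_trans le_m (le_n _ c_s).
Qed.

Lemma short_walk_visits k x c y p q :
    symmetric e -> leq_nat_ext (4 * k - 1) (girth e) ->
    path e x (c :: q) -> uniq (x :: c :: q) -> size (c :: q) < 2 * k ->
    last c q = y -> path e x p -> last x p = y -> size p < 2 * k ->
  c \in p.
Proof.
move=> e_sym girth_ge /= /andP[exc eq] /andP[xcq _] sq lq ep lp sp.
apply/negPn/negP => cp.
have xc : x != c by move: xcq; rewrite inE negb_or => /andP[].
(* Delete the edge [x c]: [p] followed by the reverse of [q] still joins [x] to
   [c], which closes a short cycle. *)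
pose e' := [rel u v | e u v && ([set u; v] != [set x; c])].
(* A walk that misses an end of the edge does not use the edge: [q] misses [x] and [p] misses
   [c]. *)
have e'_avoid z s w : w \in [set x; c] -> path e z s -> w \notin z :: s ->
    path e' z s.
  move=> w_xc; elim: s z => //= z' s IHs z /andP[ezz' es].
  rewrite inE negb_or => /andP[wz wz's]; rewrite ezz' IHs // andbT /=.
  apply: contra wz's => /eqP def_xc; move: w_xc; rewrite -def_xc !inE.
  by rewrite (negPf wz) /= => ->.
have e'_sym : symmetric e' by move=> u v; rewrite /= e_sym setUC.
have e'q : path e' c q by apply: e'_avoid eq xcq; rewrite set21.
have e'p : path e' x p.
  by apply: e'_avoid (set22 _ _) ep _; rewrite inE negb_or eq_sym xc.
pose w := p ++ rev (belast c q).
have e'w : path e' x w.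
  rewrite cat_path e'p lp -lq rev_path.
  by rewrite (eq_path (e' := e')) // => u v; rewrite e'_sym.
have lw : last x w = c.
  rewrite last_cat lp -lq; case: (q) => //= z s.
  by rewrite rev_cons last_rcons.
(* At most 2k - 1 edges from [p] and 2k - 2 from [q]; the edge [x c] then closes a cycle of length
   at most 4k - 2. *)
have sw : size w <= 4 * k - 3.
  by rewrite size_cat size_rev size_belast; move: sq sp => /=; lia.
case: (shortenP e'w) lw => s e's /[dup] Us /andP[_ Us'] s_w ls.
have /leq_trans/(_ sw) ss : size s <= size w by apply: uniq_leq_size.
have es : path e x s by apply: sub_path e's => u v /andP[].
(* With the edge [x c] deleted, joining [x] to [c] takes two edges or more, so the cycle is not
   degenerate. *)
have s_gt1 : 1 < size s.
  case: s e's ls {Us Us' s_w ss es} => [_ xE|z [|//] /= /andP[/andP[_ xz] _] zc].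
    by rewrite -xE eqxx in xc.
  by rewrite zc eqxx in xz.
have := girth_cycle girth_ge (_ : 2 < size (x :: s)) _ Us.
rewrite /= rcons_path es ls e_sym exc => /(_ s_gt1 isT).
by move: sq ss => /=; lia.
Qed.

Lemma within_midpoint k x c u p q :
    symmetric e -> path e x p -> last x p = u -> size p <= k.+1 ->
    path e u q -> size q <= k -> c \in p ++ q ->
  within k c u.
Proof.
move=> e_sym ep lp sp eq sq; rewrite mem_cat => /orP[c_p | c_q].
  (* Membership in [p] puts [c] past the first edge, so at most [k] edges remain up to [u]. *)
  case/splitPr: c_p ep lp sp => p1 p2; rewrite cat_path last_cat size_cat /=.
  by move=> /and3P[_ _ ep2] lp2 sp; exists p2; split=> //; lia.
apply: within_sym => //; case/splitPr: c_q eq sq => q1 q2.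
rewrite -cat_rcons cat_path size_cat => /andP[eq1 _] sq.
exists (rcons q1 c); split; [exact: eq1 | exact: last_rcons |].
exact: leq_trans (leq_addr _ _) sq.
Qed.

(** The step depends on [x] and [r] only, since one [c] must serve all vertices [u] that the group
    covers. *)
Definition leads_to k x c r : Prop :=
  exists q, [/\ path e x (c :: q), uniq (x :: c :: q), size (c :: q) < 2 * k
             & last c q = r].

Lemma leads_to_edge k x c r : leads_to k x c r -> e x c.
Proof. by move=> [q [/= /andP[]]]. Qed.

Lemma exists_leads_to k x r :
  within k.*2.+1 x r -> x != r -> exists c, leads_to k.+1 x c r.
Proof.
move=> [p [ep lp sp]]; case: (shortenP ep) lp => -[|c q] eq Uq q_p lq xr.
  by rewrite -lq eqxx in xr.
exists c, q; split=> //.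
have le_qp : size (c :: q) <= size p.
  by apply: uniq_leq_size => //; case/andP: Uq.
by rewrite mul2n doubleS; apply: leq_trans le_qp sp.
Qed.

Lemma leads_to_within k x c r u :
    symmetric e -> leq_nat_ext (4 * k.+1 - 1) (girth e) ->
    leads_to k.+1 x c r -> within k.+1 x u -> within k u r ->
  within k c u.
Proof.
move=> e_sym girth_ge [q [eq Uq sq lq]] [p1 [ep1 lp1 sp1]].
move=> [p2 [ep2 lp2 sp2]].
apply: (within_midpoint e_sym ep1 lp1 sp1 ep2 sp2).
apply: (short_walk_visits e_sym girth_ge eq Uq sq lq).
- by rewrite cat_path ep1 lp1.
- by rewrite last_cat lp1.
- by rewrite size_cat; lia.
Qed.

(** Groups may share a vertex, hence the sums; the inequalities leave room for idle cops. *)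
Lemma cop_turn_groups (I : finType) (A : {set I}) n (pos nxt : I -> T) C :
    (forall i, i \in A -> e (pos i) (nxt i)) ->
    (forall x, \sum_(i in A | pos i == x) 2 * n <= C x) ->
  exists C', cop_turn e C C' /\
    forall x, \sum_(i in A | nxt i == x) n <= C' x.
Proof.
move=> e_nxt leC.
pose m x y := \sum_(i in A | (pos i == x) && (nxt i == y)) n.
have sum_out x : \sum_y m x y = \sum_(i in A | pos i == x) n.
  rewrite [RHS](partition_big nxt predT) //=; apply: eq_bigr => y _.
  by apply: eq_bigl => i; rewrite andbA.
have sum_in y : \sum_x m x y = \sum_(i in A | nxt i == y) n.
  rewrite [RHS](partition_big pos predT) //=; apply: eq_bigr => x _.
  by apply: eq_bigl => i; rewrite -andbA [(nxt i == y) && _]andbC.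
exists [ffun x => C x - 2 * (\sum_y m x y) + \sum_y m y x].
split=> [|x]; last by rewrite ffunE sum_in leq_addl.
exists m; split=> [x y|x|x]; last by rewrite ffunE.
  rewrite lt0n sum_nat_eq0 negb_forall => /existsP[i].
  by rewrite negb_imply => /andP[/and3P[/e_nxt e_i /eqP<- /eqP<-] _].
by rewrite sum_out big_distrr.
Qed.

Lemma groups_capture (I : finType) k (A : {set I}) (pos : I -> T) C r :
    symmetric e -> leq_nat_ext (4 * k - 1) (girth e) ->
    (forall x, \sum_(i in A | pos i == x) 2 ^ k <= C x) ->
    (forall u, within k.-1 u r -> exists2 i, i \in A & within k (pos i) u) ->
  cops_win e C r.
Proof.
move=> e_sym.
elim: k A pos C r => [|k IHk] A pos C r girth_ge leC cover.
  have [i Ai /within0 i_r] := cover r (within_refl _ _).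
  apply: robber_on_cop; apply: leq_trans (leC r).
  by rewrite (bigD1 i) //= Ai i_r /=.
have [/existsP[i /andP[Ai /eqP i_r]] | far] :=
    boolP [exists i, (i \in A) && (pos i == r)].
  apply: robber_on_cop; apply: leq_trans (leC r).
  rewrite (bigD1 i) /=; last by rewrite Ai i_r eqxx.
  by rewrite ltn_addr ?expn_gt0.
(* The default is harmless: [B] drops the groups with no short path to [r], and their cops stay
   idle. *)
pose nxt i := odflt (pos i) [pick c | `[< leads_to k.+1 (pos i) c r >]].
pose B := [set i in A | `[< leads_to k.+1 (pos i) (nxt i) r >]].
have cover' u : within k u r -> exists2 i, i \in B & within k (nxt i) u.
  move=> ur; have [i Ai iu] := cover u ur.
  have i_r : pos i != r.
    by apply: contra far => i_r; apply/existsP; exists i; rewrite Ai.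
  have lead : leads_to k.+1 (pos i) (nxt i) r.
    rewrite /nxt; case: pickP => [c /asboolP // | no_lead].
    have := within_trans iu ur; rewrite addSn addnn => i_to_r.
    have [c /asboolP] := exists_leads_to i_to_r i_r.
    by rewrite no_lead.
  exists i; first by rewrite inE Ai; apply/asboolP.
  exact: leads_to_within e_sym girth_ge lead iu ur.
have [|x|C' [turn leC']] := @cop_turn_groups I B (2 ^ k) pos nxt C.
- by move=> i; rewrite inE => /andP[_ /asboolP/leads_to_edge].
- apply: leq_trans (leC x); rewrite -expnS.
  rewrite [leqRHS](bigID (mem B)) /= -[leqLHS]addn0 leq_add // eq_leq //.
  apply: eq_bigl => i; rewrite !inE.
  by case: (i \in A); case: (pos i == x); case: (`[< _ >]).
(* In the last turn some group steps onto [r] itself, before the robber can move. *)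
case: k => [|k] in IHk girth_ge leC cover nxt B cover' turn leC' *.
  have [i Bi /within0 i_r] := cover' r (within_refl _ _).
  apply: (capture_by_turn turn); apply: leq_trans (leC' r).
  by rewrite (bigD1 i) //= Bi i_r eqxx.
apply: (chase_by_turn turn) => r' r_r'.
apply: IHk leC' _ => [|u ur'].
  by case: (girth e) girth_ge => //= g; lia.
(* The robber's move costs one: a vertex within [k] of [r'] is within [k.+1] of [r]. *)
apply: cover'; rewrite -addn1; apply: within_trans ur' _.
apply: within_sym => //; case/predU1P: r_r' => [->|err'].
  exact: within_refl.
by exists [:: r']; rewrite /= err'.
Qed.

End Graph.

Theorem theorem10 (T : finType) (e : rel T) (d : nat)
    (e_sym : symmetric e) (e_irr : irreflexive e)
    (e_conn : connected_graph e)
    (d_gt0 : 0 < d)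
    (girth_ge : leq_nat_ext (4 * d - 1) (girth e)) :
  cop_pebbling_number e <= 2 ^ d * dist_domination_number e d.
Proof.
rewrite /dist_domination_number; case: arg_minnP => [|S /eqP domS _].
  (* The default [[set: T]] dominates: [dist] tries length 0 first, as [T] contains [u]. *)
  apply/eqP/setP => u; rewrite inE; apply/bigcupP; exists u; rewrite // inE /dist.
  case: #|T| (fintype0 u) => [/(_ erefl)[]|n _] /=.
  rewrite (_ : has_walk e 0 u u) //; apply/existsP; exists [tuple].
  by rewrite /= eqxx.
rewrite /cop_pebbling_number; case: ex_minnP => m _; apply.
apply/asboolP; exists [ffun x => \sum_(v in S | v == x) 2 ^ d]; split.
  rewrite mulnC -sum_nat_const /config_size [RHS](partition_big id predT) //=.
  by apply: eq_bigr => x _; rewrite ffunE.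
move=> r; apply: (groups_capture (pos := id) e_sym girth_ge) => [x|u _].
  by rewrite ffunE.
(* Domination gives the initial cover wherever the robber starts. *)
have : u \in [set: T] by [].
rewrite -domS => /bigcupP[v vS /dist_ball_within uv].
by exists v; last exact: within_sym.
Qed.
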